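(* Let $G$ be any group with subgroups $H$ and $K$. Suppose $X$ is any nontrivial $H$-almost invariant subset of $G$, and $Y$ is a standard $K$-almost invariant set arising from a splitting of $G$ over $K$. If $X$ crosses $Y$, then $Y$ crosses $X$.
   Context: For $X\subset G$, $X^*=G\setminus X$. A subset of $G$ is $H$-finite if it is contained in finitely many right cosets $Hg_i$. A subset $X\subset G$ is $H$-almost invariant if $hX=X$ for all $h\in H$, and for all $g\in G$ the symmetric difference of $Xg$ and $X$ is $H$-finite. It is nontrivial if neither $X$ nor $X^*$ is $H$-finite. If $X$ is $H$-almost invariant and $Y$ is $K$-almost invariant, the corners of the pair $(X,Y)$ are the four sets $X\cap Y$, $X\cap Y^*$, $X^*\cap Y$, $X^*\cap Y^*$. We say $X$ crosses $Y$ if no corner of the pair is $K$-finite. (So $Y$ crosses $X$ if no corner is $H$-finite.) A $G$-tree is a simplicial tree with a simplicial $G$-action that inverts no edge. A splitting of $G$ is a $G$-tree $T$ with no global fixed point such that $G\backslash T$ has exactly one edge; it is over $K$ if $K$ is the stabilizer of an edge. A (standard) $K$-almost invariant set arising from the splitting is a set $Y=\{g\in G : e \text{ points away from } gv\}$, where $v$ is a vertex and $e$ a directed edge of $T$ with stabilizer $K$; ''$e$ points away from $gv$'' means that $gv$ lies in the component of $T$ minus the interior of $e$ containing the initial vertex of $e$. *)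

(* Defs.v *)
From mathcomp Require Import all_boot.
From mathcomp Require Import boolp classical_sets cardinality.

Set Implicit Arguments.
Unset Strict Implicit.
Unset Printing Implicit Defensive.

Local Open Scope classical_set_scope.
Local Open Scope group_scope.

Section AlmostInvariant.
Variable G : groupType.
Implicit Types (H K X Y : set G).

Definition is_subgroup H : Prop :=
  [/\ H 1, forall x y, H x -> H y -> H (x * y) & forall x, H x -> H x^-1].

(* X is contained in the union of the right cosets H g, for g in a finite F *)
Definition coset_finite H X : Prop :=
  exists F : set G, finite_set F /\ X `<=` [set h * g | h in H & g in F].

Definition almost_invariant H X : Prop :=
  (forall h, H h -> [set h * x | x in X] = X) /\
  (forall g, coset_finite H ([set x * g | x in X] `+` X)).

Definition nontrivial H X : Prop :=
  ~ coset_finite H X /\ ~ coset_finite H (~` X).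

(* X crosses the K-almost invariant set Y; only the subgroup K attached to the
   second set of the pair enters the definition. *)
Definition crosses K X Y : Prop :=
  [/\ ~ coset_finite K (X `&` Y), ~ coset_finite K (X `&` ~` Y),
      ~ coset_finite K (~` X `&` Y) & ~ coset_finite K (~` X `&` ~` Y)].

End AlmostInvariant.

(* A simplicial tree is a one-dimensional simplicial complex, hence a simple
   graph.  For a symmetric relation every edge x y gives the cycle
   [:: x; y] of path.v, so acyclicity only concerns cycles of length >= 3. *)
Definition is_tree (V : eqType) (adj : rel V) : Prop :=
  [/\ symmetric adj,
      irreflexive adj,
      inhabited V,
      forall x y, exists2 p : seq V, path adj x p & last x p = y &
      forall c : seq V, ucycle adj c -> size c < 3].

Record gtree (G : groupType) := GTree {
  vertex :> eqType;
  adj : rel vertex;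
  act : G -> vertex -> vertex;
  adj_tree : is_tree adj;
  act1 : forall x, act 1 x = x;
  actM : forall g h x, act (g * h) x = act g (act h x);
  act_adj : forall g x y, adj (act g x) (act g y) = adj x y;
  act_no_inversion : forall g x y,
    adj x y -> ~ (act g x = y /\ act g y = x)
}.

Section GTree.
Variables (G : groupType) (T : gtree G).

(* directed edges are ordered pairs (initial vertex, terminal vertex) *)
Definition is_dedge (e : T * T) : Prop := adj e.1 e.2.

(* Since no edge is inverted, the stabilizer of an edge fixes both ends. *)
Definition edge_stab (e : T * T) : set G :=
  [set g | act g e.1 = e.1 /\ act g e.2 = e.2].

(* Any fixed point in the interior of an edge forces a fixed vertex, as there
   are no inversions; so it suffices to exclude fixed vertices. *)
Definition is_splitting : Prop :=
  [/\ ~ (exists x : T, forall g, act g x = x),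
      exists e : T * T, is_dedge e &
      forall e e' : T * T, is_dedge e -> is_dedge e' ->
        exists g, (act g e.1, act g e.2) = e' \/ (act g e.2, act g e.1) = e'].

Definition splitting_over (K : set G) : Prop :=
  is_splitting /\ exists2 e : T * T, is_dedge e & K = edge_stab e.

Definition adj_minus (e : T * T) : rel T :=
  [rel x y | [&& adj x y, (x, y) != e & (y, x) != e]].

(* x is in the component of T minus the interior of e containing e.1 *)
Definition points_away (e : T * T) (x : T) : Prop :=
  exists2 p : seq T, path (adj_minus e) e.1 p & last e.1 p = x.

Definition arises_from (K Y : set G) : Prop :=
  exists (v : T) (e : T * T),
    [/\ is_dedge e, edge_stab e = K & Y = [set g | points_away e (act g v)]].

End GTree.

(* Main.v *)
Require Import Defs.
From mathcomp Require Import all_boot.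
From mathcomp Require Import boolp classical_sets.
From mathcomp Require Import cardinality.

(** If [X `&` Y] lies in [H F] with [F] finite but is not [K]-finite, then
    [X `&` Y `&` H f] is not [K]-finite for some [f] in [F].  For any [w] in [X],
    the elements [h f] of this set with [h w] outside [Y] form a [K]-finite set,
    because a path from [f v] to [w v] in the tree has finitely many edges, each
    carried to [e] only by elements of a single coset of [K].  So
    [h w] is in [X `&` Y] for some [h], whence [w] is in [H F]: [X] itself is
    [H]-finite.  Thus an [H]-finite corner is [K]-finite, for each of the four
    corners. *)

Set Implicit Arguments.
Unset Strict Implicit.
Unset Printing Implicit Defensive.

Local Open Scope classical_set_scope.
Local Open Scope group_scope.

Section CosetFinite.
Variable G : groupType.
Implicit Types (H K X Y A B : set G).

Lemma coset_finiteS K A B : A `<=` B -> coset_finite K B -> coset_finite K A.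
Proof.
by move=> sAB [F [finF sBF]]; exists F; split=> //; apply: subset_trans sBF.
Qed.

Lemma coset_finite_bigcup K (I : Type) (D : set I) (A : I -> set G) :
  finite_set D -> (forall i, D i -> coset_finite K (A i)) ->
  coset_finite K (\bigcup_(i in D) A i).
Proof.
move=> finD finA.
have /choice[F FP] : forall i, exists F : set G,
    D i -> finite_set F /\ A i `<=` [set h * g | h in K & g in F].
  move=> i; case: (pselect (D i)) => [/finA[F FP]|nDi]; first by exists F.
  by exists set0.
exists (\bigcup_(i in D) F i); split.
  by apply: bigcup_finite => // i /FP[].
move=> x [i Di Aix]; have [_ /(_ _ Aix)[k Kk [g Fg <-]]] := FP i Di.
by exists k => //; exists g => //; exists i.
Qed.

Lemma coset_finiteU K A B :
  coset_finite K A -> coset_finite K B -> coset_finite K (A `|` B).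
Proof.
move=> [F [finF sAF]] [E [finE sBE]]; exists (F `|` E); split.
  by rewrite finite_setU.
move=> x [/sAF|/sBE] [k Kk [g Fg <-]]; exists k => //; exists g => //.
  by left.
by right.
Qed.

Lemma invariant_setC H X : is_subgroup H ->
  (forall h x, H h -> X x -> X (h * x)) ->
  forall h x, H h -> (~` X) x -> (~` X) (h * x).
Proof.
move=> [_ _ HV] HX h x Hh nXx Xhx; apply: nXx.
by rewrite -(mulKg h x); apply: HX => //; apply: HV.
Qed.

(** All that the tree contributes is that [Y a^-1] minus [Y b^-1] is [K]-finite for all [a] and [b].
    This and the invariance of [X] pass to complements, so one lemma serves all four corners. *)
Lemma coset_finite_corner H K X Y : is_subgroup H ->
  (forall h x, H h -> X x -> X (h * x)) -> ~ coset_finite H X ->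
  (forall a b, coset_finite K [set g | Y (g * a) /\ ~ Y (g * b)]) ->
  coset_finite H (X `&` Y) -> coset_finite K (X `&` Y).
Proof.
move=> [_ HM HV] HX nfinX finY [F [finF sF]].
pose A f := X `&` Y `&` [set h * f | h in H].
apply: (@coset_finiteS _ _ (\bigcup_(f in F) A f)).
  move=> x XYx; have [h Hh [f Ff hfx]] := sF _ XYx.
  by exists f => //; split=> //; exists h.
apply: coset_finite_bigcup => // f Ff; apply: contrapT => nfinA.
apply: nfinX; exists F; split=> // w Xw; apply: contrapT => nHFw.
(* Right translation by [f^-1 * w] takes [x = h * f] to [h * w]. If [h * w] were in [Y], it would
   lie in the corner, hence in [H F], and so would [w]. *)
apply: nfinA; apply: coset_finiteS (finY 1 (f^-1 * w)) => x [[_ Yx] [h Hh hfx]].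
rewrite /= mulg1; split=> //; rewrite -hfx -mulgA mulVKg => Yhw; apply: nHFw.
have [k Kk [g Fg kg]] := sF (h * w) (conj (HX _ _ Hh Xw) Yhw).
exists (h^-1 * k); first by apply: HM => //; apply: HV.
by exists g => //; rewrite -mulgA kg mulKg.
Qed.

End CosetFinite.

Section GTreeSides.
Variables (G : groupType) (T : gtree G) (e : T * T).

Lemma points_away_adj (x y : T) : adj x y -> (x, y) <> e -> (y, x) <> e ->
  points_away e x -> points_away e y.
Proof.
move=> xy /eqP xye /eqP yxe [p ep px]; exists (rcons p y).
  by rewrite rcons_path ep px /adj_minus /= xy xye yxe.
by rewrite last_rcons.
Qed.

(** Two elements carrying [(x, y)] to [e] differ by a left factor fixing [e], so one coset
    suffices. *)
Lemma transporter_coset_finite (x y : T) :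
  coset_finite (edge_stab e) [set g | (act g x, act g y) = e].
Proof.
have [[g0 g0e]|none] := pselect (exists g, (act g x, act g y) = e); last first.
  by exists set0; split=> // g ge; case: none; exists g.
exists [set g0]; split; first exact: finite_set1.
have actK g z : act g^-1 (act g z) = z :> T by rewrite -actM mulVg act1.
move=> g ge; exists (g * g0^-1); last by exists g0 => //; rewrite mulgVK.
by rewrite /edge_stab /= !actM -{1 3}g0e /= !actK -ge.
Qed.

(** Only crossing [e] changes sides, so such a [g] carries some edge of a path from [x] to [y], in
    one of its two directions, to [e]. *)
Lemma separators_coset_finite (x y : T) :
  coset_finite (edge_stab e)
    [set g | points_away e (act g x) /\ ~ points_away e (act g y)].
Proof.
have [_ _ _ /(_ x y)[p xp <-] _] := adj_tree T.
elim: p x xp => [|z p IHp] x /=; first by move=> _; exists set0; split=> // g [].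
case/andP=> xz /IHp finz.
apply: coset_finiteS (coset_finiteU (coset_finiteU
  (transporter_coset_finite x z) (transporter_coset_finite z x)) finz).
move=> g [gx ngy]; have [?|xze] := pselect ((act g x, act g z) = e).
  by left; left.
have [?|zxe] := pselect ((act g z, act g x) = e); first by left; right.
by right; split=> //; apply: points_away_adj gx; rewrite ?act_adj.
Qed.

End GTreeSides.

Theorem proposition4p2 (G : groupType) (H K X Y : set G) (T : gtree G)
  (hH : is_subgroup H) (hK : is_subgroup K)
  (hX : almost_invariant H X) (hXn : nontrivial H X)
  (hT : splitting_over T K) (hY : arises_from T K Y)
  (hXY : crosses K X Y) :
  crosses H Y X.
Proof.
(* [g * a] is in [Y] exactly when [e] points away from [g (a v)], so this set consists of elements
   separating [a v] from [b v]. *)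
have finY a b : coset_finite K [set g | Y (g * a) /\ ~ Y (g * b)].
  have [v [e [_ <- ->]]] := hY.
  apply: coset_finiteS (separators_coset_finite e (act a v) (act b v)).
  by move=> g /=; rewrite !actM.
have finYC a b : coset_finite K [set g | (~` Y) (g * a) /\ ~ (~` Y) (g * b)].
  by apply: coset_finiteS (finY b a) => g [nYa /contrapT Yb].
have HX h x : H h -> X x -> X (h * x).
  by move=> Hh Xx; rewrite -(hX.1 h Hh); exists x.
have HXC := invariant_setC hH HX.
have [nX nXC] := hXn; have [n1 n2 n3 n4] := hXY.
(* Swapping the pair exchanges the two mixed corners, hence [n3] before [n2]. *)
split; rewrite setIC => fin.
- by apply: n1; apply: coset_finite_corner fin.
- by apply: n3; apply: coset_finite_corner fin.
- by apply: n2; apply: coset_finite_corner fin.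
- by apply: n4; apply: coset_finite_corner fin.
Qed.
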